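(* Let $m$ be a positive integer, let $F$ be a finite field of order $4^m$, let $d=4(\sqrt{|F|}-1)+1$, for $a \in F$ let $W_{F,d}(a)=\sum_{x \in F} \psi_F(x^d-ax)$, where $\psi_F$ is the canonical additive character of $F$, and let $\mathcal{W}=\{W_{F,d}(a)/\sqrt{|F|}: a \in F^*\}$. Then: (i) If $m$ is even, then $\mathcal{W} \subseteq \{-1,0,1,2,4\}$. (ii) If $m$ is odd and greater than $1$, then $\mathcal{W} \subseteq \{-1,0,1,2,3,4\}$. (iii) If $F=\mathbb{F}_4$, then $d$ is degenerate over $F$ and $\mathcal{W}=\{0,2\}$.
   Context: $F^*$ denotes the group of units of $F$. For a finite field $F$ of characteristic $p$ and order $p^n$, let $\operatorname{Tr}\colon F \to \mathbb{F}_p$, $\operatorname{Tr}(x)=x+x^p+\cdots+x^{p^{n-1}}$, be the absolute trace; the canonical additive character is $\psi_F\colon F\to\mathbb{C}$, $\psi_F(x)=\exp(2\pi i \operatorname{Tr}(x)/p)$. (In characteristic $2$, $\psi_F(x)=(-1)^{\operatorname{Tr}(x)}$.) The Weil sum $W_{F,d}(a)$ is considered for positive integers $d$ with $\gcd(d,p^n-1)=1$; this holds automatically for the $d$ in the claim. An exponent $d$ is degenerate over $F=\mathbb{F}_{p^n}$ if $d$ is congruent to a power of $p$ modulo $p^n-1$. *)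

(* Defs.v *)
From HB Require Import structures.
From mathcomp Require Import all_boot all_order all_fingroup all_algebra all_field.
From mathcomp Require Import complex.
From mathcomp Require Import classical_sets reals trigo.

Set Implicit Arguments.
Unset Strict Implicit.
Unset Printing Implicit Defensive.

Import Order.TTheory GRing.Theory Num.Theory.

Local Open Scope ring_scope.

Definition fchar (F : finFieldType) : nat := s2val (finPcharP F).

Definition fdeg (F : finFieldType) : nat := logn (fchar F) #|F|.

Definition trace_elt (F : finFieldType) (x : F) : F :=
  \sum_(i < fdeg F) x ^+ (fchar F ^ i)%N.

(* The trace lies in the prime subfield; [abs_trace] is the corresponding
   element of 'F_p (unique, and always found: see [abs_traceE]). *)
Definition abs_trace (F : finFieldType) (x : F) : 'F_(fchar F) :=
  odflt 0 [pick k : 'F_(fchar F) | (k : nat)%:R == trace_elt x].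

Definition cis (R : realType) (t : R) : R[i] := Complex (cos t) (sin t).

(* exp (2 i pi Tr(x) / p); the representative of Tr(x) in {0, ..., p-1} is
   used, which does not matter since exp (2 i pi k / p) is p-periodic in k. *)
Definition psi (R : realType) (F : finFieldType) (x : F) : R[i] :=
  cis (2 * pi * (abs_trace x : nat)%:R / (fchar F)%:R).

Definition weil_sum (R : realType) (F : finFieldType) (d : nat) (a : F) : R[i] :=
  \sum_(x : F) psi R (x ^+ d - a * x).

Definition sqrt_card (R : realType) (F : finFieldType) : R :=
  Num.sqrt (#|F|%:R).

Definition weil_values (R : realType) (F : finFieldType) (d : nat) : set R[i] :=
  [set w | exists2 a : F, a \is a GRing.unit &
             w = weil_sum R d a / real_complex R (sqrt_card R F)]%classic.
Arguments weil_values R F d : clear implicits.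

Definition degenerate (F : finFieldType) (d : nat) : Prop :=
  exists k : nat, (d = fchar F ^ k %[mod #|F|.-1])%N.

Lemma fchar_prime (F : finFieldType) : prime (fchar F).
Proof. exact: s2valP (finPcharP F). Qed.

Lemma fcharP (F : finFieldType) : fchar F \in [pchar F].
Proof. exact: s2valP' (finPcharP F). Qed.

Lemma fdegE (F : finFieldType) : #|F| = (fchar F ^ fdeg F)%N.
Proof. exact: card_pprimeChar (fcharP F). Qed.

Lemma trace_elt_frob (F : finFieldType) (x : F) :
  trace_elt x ^+ fchar F = trace_elt x.
Proof.
have chF := fcharP F.
rewrite /trace_elt -(pFrobenius_autE chF) rmorph_sum /=.
under eq_bigr => i _ do rewrite pFrobenius_autE -exprM -expnSr.
case E: (fdeg F) => [|n]; first by rewrite !big_ord0.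
rewrite big_ord_recr big_ord_recl /= -E -fdegE expf_card expn0 expr1.
by rewrite addrC.
Qed.

Lemma abs_traceE (F : finFieldType) (x : F) :
  (abs_trace x : nat)%:R = trace_elt x.
Proof.
rewrite /abs_trace; case: pickP => [k /eqP //|noK].
have p_pr := fchar_prime F; have chF := fcharP F.
set p := fchar F in noK p_pr chF *; set y := trace_elt x in noK *.
have p_gt1 := prime_gt1 p_pr.
pose P : {poly F} := 'X^p - 'X.
have szP : size P = p.+1.
  by rewrite size_polyDl size_polyXn // size_polyN size_polyX.
have P0 : P != 0 by rewrite -size_poly_eq0 szP.
pose s := y :: [seq (nat_of_ord k)%:R | k <- enum 'I_p].
have natP (k : 'I_p) : (k%:R == y) = false.
  have kp : (k < (Zp_trunc (pdiv p)).+2)%N by rewrite Zp_cast ?pdiv_id.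
  exact: noK (Ordinal kp).
have us : uniq s.
  rewrite /= map_inj_uniq ?enum_uniq ?andbT.
    by apply/mapP => -[k _ yk]; have := natP k; rewrite yk eqxx.
  move=> i j /eqP; wlog le_ij : i j / (j <= i)%N.
    by move=> W; case/orP: (leq_total j i) => h e; [|symmetry];
       apply: W => //; rewrite eq_sym.
  rewrite -subr_eq0 -natrB // -(dvdn_pcharf chF) => dv.
  apply/val_inj/eqP; rewrite eqn_leq le_ij andbT -subn_eq0; apply: contraLR dv.
  rewrite -lt0n => lt0; rewrite gtnNdvd //.
  exact: leq_ltn_trans (leq_subr _ _) (ltn_ord i).
have rs : all (root P) s.
  rewrite /= rootE !hornerE trace_elt_frob subrr eqxx /=.
  apply/allP => _ /mapP [k _ ->].
  by rewrite rootE !hornerE -(pFrobenius_autE chF) rmorph_nat subrr.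
have := max_poly_roots P0 rs us.
by rewrite /= size_map size_enum_ord szP ltnn.
Qed.

(* Main.v *)
(* Write q = 2^m and b = a^q. Niho: since y^d = y on the subfield of order q,
   summing psi (T(v) (x^d + a x)) over all v and x, with T(v) = v + v^q, in both
   orders gives W = q (N - 1), where N is the number of roots z of
   f = z^7 + a z^4 + b z^3 + 1 on the unit circle z^(q+1) = 1.

   If ab = 1, then f = (z^4 + b)(z^3 + a), so N <= 4, and N <= 2 for m even.
   Otherwise f has seven distinct roots r_i in an algebraic closure. With
   w_ij = r_i / (r_i + r_j), the product over j of the 1 + w_ij X is
   1 + X + X^2 modulo X^3. Multiplying over i and comparing coefficients of X^2
   gives that the sum of w_ij (1 + w_ij) over i < j is 0, so S, the sum of w_ij
   over i < j, lies in the prime field. If N is 4, 6 or 7, then x -> x^(-q),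
   which permutes the roots, has a cube fixing all of them; hence x -> x^(q^3)
   maps w_ij to w_ij + 1, and S to S + 21 = S + 1, which is absurd. *)
Require Import Defs.
From mathcomp Require Import all_boot all_order all_algebra all_field.
From mathcomp Require Import complex.
From mathcomp Require Import classical_sets reals trigo.
From mathcomp Require Import ring zify.

Import Order.TTheory GRing.Theory Num.Theory.
Local Open Scope ring_scope.

(** * The polynomial f and arithmetic in characteristic 2 *)

Definition niho_poly {K : nzRingType} (a b : K) : {poly K} :=
  'X^7 + a%:P * 'X^4 + b%:P * 'X^3 + 1.

Lemma horner_niho (K : comNzRingType) (a b x : K) :
  (niho_poly a b).[x] = x ^+ 7 + a * x ^+ 4 + b * x ^+ 3 + 1.
Proof. by rewrite /niho_poly !hornerE. Qed.

Lemma comp_niho (K : comNzRingType) (a b : K) (q : {poly K}) :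
  niho_poly a b \Po q = q ^+ 7 + a%:P * q ^+ 4 + b%:P * q ^+ 3 + 1.
Proof.
rewrite !comp_polyD !(comp_polyM _%:P) !comp_Xn_poly -[1]/(1%:P).
by rewrite !comp_polyC.
Qed.

(** Modulo X^3 every factor is 1 + X + c X^2, so a term of degree 2 in the product uses either one c
    or two of the X. *)
Lemma coef2_prod_seq (R : comNzRingType) (I : Type) (s : seq I)
    (P : I -> {poly R}) :
  (forall i, (P i)`_0 = 1) -> (forall i, (P i)`_1 = 1) ->
  let Q := \prod_(i <- s) P i in
  [/\ Q`_0 = 1, Q`_1 = (size s)%:R &
      Q`_2 = 'C(size s, 2)%:R + \sum_(i <- s) (P i)`_2].
Proof.
move=> P0 P1 /=; elim: s => [|i s [Q0 Q1 Q2]].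
  by rewrite !big_nil !coef1 addr0.
rewrite !big_cons !coefM !big_ord_recl !big_ord0 /= !P0 !P1.
rewrite Q0 Q1 Q2 binS bin1 natrD -natr1; split; by ring.
Qed.

Lemma natr_pchar2 (R : nzRingType) n : 2%N \in [pchar R] ->
  n%:R = (odd n)%:R :> R.
Proof.
move=> R2; rewrite -[in LHS](odd_double_half n) natrD -addnn natrD.
by rewrite addrr_pchar2 // addr0.
Qed.

Lemma exprDn_pchar2 (R : comNzRingType) k (x y : R) : 2%N \in [pchar R] ->
  (x + y) ^+ (2 ^ k) = x ^+ (2 ^ k) + y ^+ (2 ^ k).
Proof. by move=> R2; rewrite exprDn_pchar // pnatX pnatE // R2. Qed.

Lemma expr_sum_pchar2 (R : comNzRingType) k (I : Type) (s : seq I) P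
    (F : I -> R) : 2%N \in [pchar R] ->
  (\sum_(i <- s | P i) F i) ^+ (2 ^ k) = \sum_(i <- s | P i) F i ^+ (2 ^ k).
Proof.
move=> R2; apply: (big_morph (fun x => x ^+ (2 ^ k))) => [x y|].
  exact: exprDn_pchar2.
by rewrite expr0n expn_eq0.
Qed.

Lemma niho_root_neq0 (K : fieldType) (a b x : K) :
  (niho_poly a b).[x] = 0 -> x != 0.
Proof.
move=> fx; apply/eqP => x0; move: fx; rewrite horner_niho x0 !expr0n /=.
by rewrite !mulr0 !add0r => /eqP; rewrite oner_eq0.
Qed.

(** Where x^4 = b, the two terms in x^3 cancel and f takes the value ab + 1. In characteristic 2 the
    derivative of f is x^2 times this quartic. *)
Lemma niho_root_quartic_neq0 (K : fieldType) (a b x : K) :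
  2%N \in [pchar K] -> a * b != 1 -> (niho_poly a b).[x] = 0 -> x ^+ 4 + b != 0.
Proof.
move=> K2; have add2 (y : K) : y + y = 0 by exact: addrr_pchar2.
rewrite horner_niho => /negP ab1 fx; apply/eqP => xb; apply: ab1.
rewrite -subr_eq0 GRing.subr_pchar2 //.
have xE : x ^+ 4 = b by rewrite -[LHS]addr0 -(add2 b) addrA xb add0r.
move: fx; rewrite (_ : 7 = 4 + 3)%N // exprD xE => /eqP.
by rewrite [b * _ + _]addrC -[a * b + _ + _]addrA add2 addr0.
Qed.

(** * Ratios of the seven roots of f *)

Section PairRatios.
Variables (K : fieldType) (a b : K) (r : 'I_7 -> K).
Hypotheses (K2 : 2%N \in [pchar K]) (ab1 : a * b != 1).
Hypothesis (niho_r : niho_poly a b = \prod_i ('X - (r i)%:P)).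

Let ratio i j := r i / (r i + r j).

Lemma niho_root i : (niho_poly a b).[r i] = 0.
Proof.
by rewrite niho_r (bigD1 i) //= hornerM hornerXsubC subrr mul0r.
Qed.

Lemma niho_r_neq0 i : r i != 0.
Proof. exact: niho_root_neq0 (niho_root i). Qed.

Lemma niho_deriv_neq0 i : r i ^+ 4 + b != 0.
Proof. exact: niho_root_quartic_neq0 (niho_root i). Qed.

(* The product is, up to the factor [r_i X], the value of the polynomial at
   [(1 + X) r_i], which is easy to expand. *)
Lemma niho_row i :
  let P := \prod_(j | j != i) ((r i + r j)%:P + r i *: 'X) in
  [/\ P`_0 = r i ^+ 2 * (r i ^+ 4 + b),
      P`_1 = r i ^+ 2 * (r i ^+ 4 + b) & P`_2 = r i ^+ 2 * (r i ^+ 4 + b)].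
Proof.
move=> P.
have addrxx (x : {poly K}) : x + x = 0.
  by apply: addrr_pchar2; rewrite pchar_poly.
have E : r i *: ('X * P) = (niho_poly a b) \Po (r i *: (1 + 'X)).
  rewrite niho_r rmorph_prod /= (bigD1 i) //= scalerAl; congr (_ * _).
    rewrite comp_polyB comp_polyX comp_polyC scalerDr alg_polyC.
    by rewrite addrAC subrr add0r.
  apply: eq_bigr => j _; rewrite comp_polyB comp_polyX comp_polyC.
  rewrite scalerDr alg_polyC polyCD addrAC; congr (_ + _ + _).
  by rewrite -polyCN oppr_pchar2.
have root_i := niho_root i.
set s := r i in E root_i *.
(* In the expansion of f at (1 + X)s, X^4 [G] gathers the degrees from 4 on, and [H] is half the
   excess of the lower coefficients over the wanted ones, such as 3 = (7 - 1) / 2, so that [H + H]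
   vanishes. *)
pose G : {poly K} := s%:P ^+ 7 * (35%:R + 21%:R * 'X + 7%:R * 'X^2 + 'X^3)
  + a%:P * s%:P ^+ 4.
pose H : {poly K} := s%:P ^+ 7 * (3%:R + 10%:R * 'X + 17%:R * 'X^2)
  + a%:P * s%:P ^+ 4 * (2%:R + 3%:R * 'X + 2%:R * 'X^2)
  + b%:P * s%:P ^+ 3 * (1 + 'X).
have {}E : s *: P = (s ^+ 3 * (s ^+ 4 + b)) *: (1 + 'X + 'X^2) + 'X^3 * G.
  apply: (mulfI (x := 'X)); first by rewrite polyX_eq0.
  rewrite -scalerAr E.
  transitivity ((niho_poly a b).[s]%:P +
    'X * ((s ^+ 3 * (s ^+ 4 + b)) *: (1 + 'X + 'X^2) + 'X^3 * G) +
    'X * (H + H)).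
    rewrite horner_niho comp_niho -!mul_polyC.
    rewrite !(polyCD, polyCM, polyC_exp) /G /H; ring.
  by rewrite addrxx mulr0 addr0 root_i add0r.
have coefP k : (k < 3)%N -> P`_k = s ^+ 2 * (s ^+ 4 + b).
  move=> k3; apply: (mulfI (niho_r_neq0 i)); rewrite -/s -coefZ E.
  rewrite coefD coefXnM k3 addr0 coefZ !coefD coef1 coefX coefXn.
  by case: k k3 => [|[|[|]]] //= _; ring.
by rewrite !coefP.
Qed.

(** The factor [r i + r j] divides the constant coefficient in [niho_row], which is nonzero. *)
Lemma niho_r_add_neq0 i j : j != i -> r i + r j != 0.
Proof.
move=> ji; have [P0 _ _] := niho_row i; move: P0.
rewrite (bigD1 j) //= coef0M coefD coefC coefZ coefX mulr0 addr0 => P0.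
have := mulf_neq0 (expf_neq0 2 (niho_r_neq0 i)) (niho_deriv_neq0 i).
by rewrite -P0 mulf_eq0 negb_or => /andP[].
Qed.

(** Dividing each factor in [niho_row] by [r i + r j] divides the three equal coefficients by their
    common value. *)
Lemma ratio_row i :
  let P := \prod_(j | j != i) (1 + ratio i j *: 'X) in
  [/\ P`_0 = 1, P`_1 = 1 & P`_2 = 1].
Proof.
set c := r i ^+ 2 * (r i ^+ 4 + b).
have c0 : c != 0 := mulf_neq0 (expf_neq0 2 (niho_r_neq0 i)) (niho_deriv_neq0 i).
have [P0 P1 P2] := niho_row i; move=> P.
have E : \prod_(j | j != i) ((r i + r j)%:P + r i *: 'X) = c *: P.
  have -> : c = \prod_(j | j != i) (r i + r j).
    rewrite /c -P0 -horner_coef0 horner_prod; apply: eq_bigr => j _.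
    by rewrite !hornerE.
  rewrite -[RHS]mul_polyC rmorph_prod -big_split /=; apply: eq_bigr => j ji.
  rewrite mulrDr mulr1 -!mul_polyC mulrA -rmorphM /= /ratio.
  by rewrite mulrCA mulfV ?mulr1 // niho_r_add_neq0.
rewrite E !coefZ -/c in P0 P1 P2.
by split; apply: (mulfI c0); rewrite mulr1.
Qed.

Lemma ratio_sym i j : j != i -> ratio j i = ratio i j + 1.
Proof.
move=> ji; have h := niho_r_add_neq0 i j ji.
rewrite -(oppr_pchar2 K2 (ratio i j)) /ratio [r j + r i]addrC.
by field.
Qed.

Lemma prod_neq_pairs (F : 'I_7 -> 'I_7 -> {poly K}) :
  \prod_i \prod_(j | j != i) F i j =
  \prod_(p : 'I_7 * 'I_7 | (p.1 < p.2)%N) (F p.1 p.2 * F p.2 p.1).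
Proof.
rewrite pair_big_dep /= big_split /=.
rewrite (bigID (fun p : 'I_7 * 'I_7 => p.1 < p.2)%N) /=.
congr (_ * _).
  by apply: eq_bigl => p; rewrite andb_idl // => /ltn_eqF/negbT; rewrite eq_sym.
rewrite (reindex_inj (h := fun p => (p.2, p.1))) /=; last first.
  by move=> [? ?] [? ?] [-> ->].
by apply: eq_bigl => p; rewrite -leqNgt ltn_neqAle.
Qed.

Definition pair_sum := \sum_(p : 'I_7 * 'I_7 | (p.1 < p.2)%N) ratio p.1 p.2.

Lemma size_pairs : \sum_(p : 'I_7 * 'I_7 | (p.1 < p.2)%N) 1 = 21%N.
Proof.
rewrite -(pair_big_dep predT (fun i j : 'I_7 => i < j)%N (fun _ _ => 1%N)) /=.
under eq_bigr do rewrite big_mkcond.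
by rewrite !big_ord_recl !big_ord0.
Qed.

(* Compare the coefficients of [X ^ 2] on both sides of [prod_neq_pairs]. *)
Lemma pair_sum_idem : pair_sum ^+ 2 = pair_sum.
Proof.
pose s := [seq p : 'I_7 * 'I_7 <- index_enum _ | (p.1 < p.2)%N].
pose w (p : 'I_7 * 'I_7) := ratio p.1 p.2.
have size_s : size s = 21%N.
  by rewrite size_filter -sum1_count size_pairs.
have nat2 n : n%:R = (odd n)%:R :> K by exact: natr_pchar2.
have [|| _ _ rows] := coef2_prod_seq K 'I_7 (index_enum 'I_7)
    (fun i => \prod_(j | j != i) (1 + ratio i j *: 'X)).
- by move=> i; have [] := ratio_row i.
- by move=> i; have [] := ratio_row i.
have [|| _ _ cols] := coef2_prod_seq K _ s
    (fun p => 1 + 'X + (w p ^+ 2 + w p) *: 'X^2).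
- by move=> p; rewrite !coefD coef1 coefX coefZ coefXn /= mulr0 !addr0.
- by move=> p; rewrite !coefD coef1 coefX coefZ coefXn /= mulr0 addr0 add0r.
(* With w = w_ij, the pair contributes (1 + w X)(1 + (w + 1) X), whose X coefficient 2w + 1 is 1. *)
have E : \prod_(p <- s) (1 + 'X + (w p ^+ 2 + w p) *: 'X^2) =
         \prod_i \prod_(j | j != i) (1 + ratio i j *: 'X).
  rewrite prod_neq_pairs big_filter; apply: eq_bigr => p p12.
  have p21 : p.2 != p.1 by rewrite -val_eqE gtn_eqF.
  rewrite (ratio_sym p.1 p.2) // -/(w p) -!mul_polyC.
  rewrite !rmorphD rmorphXn rmorph1 /=.
  rewrite -[LHS]addr0 -[0](@addrr_pchar2 _ _ ((w p)%:P * 'X)) ?pchar_poly //.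
  by ring.
rewrite E rows size_s in cols.
have R2 i : (\prod_(j | j != i) (1 + ratio i j *: 'X))`_2 = 1.
  by have [] := ratio_row i.
have size7 : size (index_enum 'I_7) = 7%N.
  by rewrite /index_enum unlock -enumT size_enum_ord.
move: cols; under eq_bigr => i _ do rewrite R2.
under [X in _ = _ + X]eq_bigr => p _ do
  rewrite !coefD coef1 coefX coefZ coefXn /= !add0r mulr1.
(* The row side is 21 + 7 = 0; on the pair side 'C(21, 2) = 210 is even, which leaves the sum of the
   w^2 + w. *)
rewrite sumr_const card_ord size7 (nat2 7) (nat2 'C(7, 2)) (nat2 'C(21, 2)).
rewrite /= addrr_pchar2 // add0r big_filter big_split /=.
rewrite -(expr_sum_pchar2 _ 1) // -/pair_sum => /esym S0.
by apply/eqP; rewrite -subr_eq0 GRing.subr_pchar2 //; apply/eqP.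
Qed.

(* If every root satisfies [r^(Q+1) = 1], then [x -> x^Q] exchanges
   [r_i / (r_i + r_j)] and [r_j / (r_i + r_j)], so it adds [21 = 1] to
   [pair_sum], which lies in the prime field. *)
Lemma not_all_unit_circle k : ~ (forall i, r i ^+ (2 ^ k).+1 = 1).
Proof.
move=> r1.
have rQ i : r i ^+ (2 ^ k) = (r i)^-1.
  by apply: (mulfI (niho_r_neq0 i)); rewrite -exprS r1 divff ?niho_r_neq0.
have idem n : pair_sum ^+ (2 ^ n) = pair_sum.
  by elim: n => [|n IH]; rewrite ?expr1 // expnS exprM pair_sum_idem IH.
have := idem k; rewrite expr_sum_pchar2 //.
under eq_bigr => p p12.
  have p21 : p.2 != p.1 by rewrite -val_eqE gtn_eqF.
  have s0 := niho_r_add_neq0 _ _ p21.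
  have -> : ratio p.1 p.2 ^+ (2 ^ k) = ratio p.1 p.2 + 1.
    rewrite -ratio_sym // /ratio expr_div_n exprDn_pchar2 // !rQ.
    by field; rewrite addrC s0 !niho_r_neq0.
  over.
have sum1 : \sum_(p : 'I_7 * 'I_7 | (p.1 < p.2)%N) 1 = 1 :> K.
  by rewrite -(natr_sum K _ _ (fun=> 1%N)) size_pairs natr_pchar2.
rewrite big_split /= -/pair_sum sum1.
by move/eqP; rewrite -subr_eq0 addrAC subrr add0r oner_eq0.
Qed.
End PairRatios.

(** * Roots on the unit circle when ab differs from 1 *)

(** A permutation without fixed points cannot exist on one point and is a 3-cycle on three. Size 2
    is left out because a transposition is not its own inverse square. *)
Lemma iter3_fixed_point_free (T : eqType) (phi : T -> T) (t : seq T) :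
  injective phi -> uniq t -> size t \in [:: 0; 1; 3]%N ->
  {in t, forall x, phi x \in t /\ phi x != x} ->
  {in t, forall x, phi (phi (phi x)) = x}.
Proof.
move=> phiI; case: t => [|x [|y [|z [|]]]] //= ut _ phit.
  by have [] := phit x (mem_head _ _); rewrite inE => /eqP ->; rewrite eqxx.
have tE u : u \in [:: x; y; z] -> [\/ u = x, u = y | u = z].
  by rewrite !inE => /or3P[] /eqP ->;
    [constructor 1|constructor 2|constructor 3].
have [xt yt zt] :
    [/\ x \in [:: x; y; z], y \in [:: x; y; z] & z \in [:: x; y; z]].
  by rewrite !inE !eqxx !orbT.
move: ut; rewrite !inE negb_or andbT => /andP[/andP[/eqP xy /eqP xz] /eqP yz].
have [/tE px /eqP px'] := phit x xt; have [/tE py /eqP py'] := phit y yt.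
have [/tE pz /eqP pz'] := phit z zt.
have pxy e : phi x = e -> phi y = e -> False.
  by move=> h1 h2; apply/xy/phiI; rewrite h1.
have pxz e : phi x = e -> phi z = e -> False.
  by move=> h1 h2; apply/xz/phiI; rewrite h1.
have pyz e : phi y = e -> phi z = e -> False.
  by move=> h1 h2; apply/yz/phiI; rewrite h1.
have cyc : [/\ phi (phi (phi x)) = x, phi (phi (phi y)) = y &
               phi (phi (phi z)) = z].
  case: px => // px; case: py => // py; case: pz => // pz;
  do ?[by case: (pxy _ px py) | by case: (pxz _ px pz)
      | by case: (pyz _ py pz)];
  by rewrite ?(px, py, pz).
by case: cyc => ? ? ? u /tE[] ->.
Qed.

Lemma size_niho (K : nzRingType) (a b : K) : size (niho_poly a b) = 8%N.
Proof.
rewrite /niho_poly -!addrA size_polyDl size_polyXn //.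
rewrite (leq_ltn_trans (size_polyD _ _)) // gtn_max mul_polyC.
rewrite (leq_ltn_trans (size_scale_leq _ _)) ?size_polyXn //=.
rewrite (leq_ltn_trans (size_polyD _ _)) // gtn_max mul_polyC size_poly1.
by rewrite (leq_ltn_trans (size_scale_leq _ _)) ?size_polyXn.
Qed.

Lemma monic_niho (K : nzRingType) (a b : K) : niho_poly a b \is monic.
Proof.
rewrite monicE lead_coefE size_niho /niho_poly !coefD !coefCM !coefXn coef1 /=.
by rewrite !mulr0 !addr0.
Qed.

Lemma horner_niho_frobenius (K : comNzRingType) (k : nat) (a b x : K) :
  2%N \in [pchar K] ->
  (niho_poly a b).[x] ^+ (2 ^ k) =
  (niho_poly (a ^+ (2 ^ k)) (b ^+ (2 ^ k))).[x ^+ (2 ^ k)].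
Proof.
move=> K2; rewrite !horner_niho !exprDn_pchar2 // expr1n.
by rewrite [(a * _) ^+ _]exprMn [(b * _) ^+ _]exprMn ![x ^+ (2 ^ k) ^+ _]exprAC.
Qed.

(** The derivative is x^2 (x^4 + b), and neither factor vanishes at a root of f. *)
Lemma niho_separable (K : closedFieldType) (a b : K) :
  2%N \in [pchar K] -> a * b != 1 -> separable_poly (niho_poly a b).
Proof.
move=> K2 ab1.
have add2 (x : K) : x + x = 0 by exact: addrr_pchar2.
rewrite unlock; apply/Pdiv.ClosedField.coprimepP => x /rootP fx.
have x0 := niho_root_neq0 _ _ _ _ fx.
have x4 := niho_root_quartic_neq0 _ _ _ _ K2 ab1 fx.
have -> : (niho_poly a b)^`().[x] = x ^+ 2 * (x ^+ 4 + b).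
  rewrite /niho_poly !derivE !hornerE /= -[RHS]addr0.
  rewrite -(add2 (3%:R * x ^+ 6 + 2%:R * a * x ^+ 3 + b * x ^+ 2)).
  by ring.
by rewrite mulf_neq0 ?expf_neq0.
Qed.

Lemma unit_circle_niho_roots (F : finFieldType) (m : nat) (a : F) :
  2%N \in [pchar F] -> #|F| = (2 ^ m * 2 ^ m)%N -> a ^+ (2 ^ m).+1 != 1 ->
  #|[set z : F | (z ^+ (2 ^ m).+1 == 1) && root (niho_poly a (a ^+ (2 ^ m))) z]|
    \in [:: 0; 1; 2; 3; 5]%N.
Proof.
move=> F2 cardF a1; set A := [set z | _]; set q := (2 ^ m)%N in cardF a1 A *.
have q0 : (0 < q)%N by rewrite expn_gt0.
have [K [iota _]] := countable_algebraic_closure F.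
have K2 : 2%N \in [pchar K] by rewrite (rmorph_pchar iota).
set b := a ^+ q in A *.
pose f := niho_poly (iota a) (iota b).
have fE : f = map_poly iota (niho_poly a b).
  apply/polyP => i; rewrite coef_map /= /f /niho_poly.
  rewrite !coefD !coefCM !coefXn coef1.
  by rewrite !rmorphD !rmorphM !rmorph_nat !coef1 rmorph_nat.
have ab1 : iota a * iota b != 1.
  by rewrite -rmorphM -exprS fmorph_eq1.
have [s] := closed_field_poly_normal f.
rewrite (monicP (monic_niho _ _ _)) scale1r => fs.
have size_s : size s = 7%N.
  by apply: succn_inj; rewrite -(size_prod_XsubC s id) -fs size_niho.
have uniq_s : uniq s by rewrite -separable_prod_XsubC -fs niho_separable.
have mem_s x : (x \in s) = root f x by rewrite fs root_prod_XsubC.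
pose phi (x : K) := (x ^+ q)^-1.
have phiI : injective phi.
  move=> x y /invr_inj /eqP; rewrite -subr_eq0 GRing.subr_pchar2 //.
  rewrite -exprDn_pchar2 // expf_eq0 q0 /= -GRing.subr_pchar2 // subr_eq0.
  by move/eqP.
have s_neq0 x : x \in s -> x != 0.
  by rewrite mem_s => /rootP /niho_root_neq0.
(* Raising f(x) = 0 to the power q exchanges a and b; dividing by x^(7q) then reverses the
   polynomial and gives f(x^(-q)) = 0. *)
have phi_s x : x \in s -> phi x \in s.
  move=> xs; have x0 := s_neq0 x xs; move: xs; rewrite !mem_s /root => /eqP fx.
  have := horner_niho_frobenius K m (iota a) (iota b) x K2.
  rewrite fx expr0n expn_eq0 /= -/q !rmorphXn /= -!exprM.
  have -> : iota a ^+ (q * q) = iota a by rewrite -rmorphXn -cardF expf_card.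
  rewrite !horner_niho /phi => /esym fxq; apply/eqP.
  have xq0 : x ^+ q != 0 by rewrite expf_neq0.
  apply: (mulfI (expf_neq0 7 xq0)); rewrite mulr0 -[RHS]fxq.
  rewrite -(rmorphXn iota) -/b.
  by move: (x ^+ q) xq0 => y y0; field.
have phi_fix x : x != 0 -> (phi x == x) = (x ^+ q.+1 == 1).
  move=> x0; rewrite /phi -(inj_eq (mulIf (expf_neq0 q x0))).
  by rewrite mulVf ?expf_neq0 // -exprS eq_sym.
pose t := [seq x <- s | x ^+ q.+1 != 1].
have size_t : (size t + #|A| = 7)%N.
  rewrite -size_s -(count_predC (fun x => x ^+ q.+1 != 1) s) size_filter.
  congr (_ + _)%N; rewrite -size_filter cardE -(size_map iota).
  apply/perm_size/uniq_perm.
  - by rewrite map_inj_uniq ?enum_uniq //; apply: fmorph_inj.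
  - exact: filter_uniq.
  move=> x; rewrite mem_filter /= negbK mem_s fE; apply/mapP/andP.
    case=> z; rewrite mem_enum inE => /andP[/eqP z1 fz] ->.
    by rewrite -rmorphXn z1 rmorph1 eqxx fmorph_root.
  case=> /eqP x1.
  (* On the unit circle of [K], x^q = 1/x, so x^(q^2) = x and x comes from [F]. *)
  have : root ('X^#|F| - 'X) x.
    rewrite /root !hornerE cardF; apply/eqP.
    have x0 : x != 0.
      apply/eqP => x0; move/eqP: x1.
      by rewrite x0 expr0n eq_sym oner_eq0.
    have xq : x ^+ q = x^-1 by apply: (mulfI x0); rewrite -exprS x1 divff.
    by rewrite exprM xq exprVn xq invrK subrr.
  rewrite (_ : 'X^#|F| - 'X = map_poly iota ('X^#|F| - 'X)); last first.
    by rewrite rmorphB /= map_polyXn map_polyX.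
  rewrite finField_genPoly rmorph_prod /= => /rootP.
  rewrite horner_prod => /eqP /prodf_eq0[z _].
  rewrite map_polyXsubC hornerXsubC subr_eq0 => /eqP xz.
  rewrite {1}xz fmorph_root => fz.
  exists z => //; rewrite mem_enum inE fz andbT.
  by rewrite -(fmorph_eq1 iota) rmorphXn -xz x1.
(* By [size_t], these sizes are the counts 7, 6 and 4 to be excluded. *)
have [|] := boolP (size t \in [:: 0; 1; 3]%N); last first.
  by rewrite !inE; move: size_t; lia.
move=> szt; exfalso.
have cyc : {in t, forall x, phi (phi (phi x)) = x}.
  apply: iter3_fixed_point_free => //; first exact: filter_uniq.
  move=> x; rewrite !mem_filter => /andP[x1 xs].
  have x0 := s_neq0 x xs; have px0 := s_neq0 _ (phi_s x xs).
  rewrite -phi_fix // in x1; split; last by [].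
  by rewrite -phi_fix // (inj_eq phiI) x1 phi_s.
pose r (i : 'I_7) := nth 0 s i.
have fr : f = \prod_i ('X - (r i)%:P).
  by rewrite fs (big_nth 0) size_s big_mkord.
(* Since 2^(3m) = q^3 and the cube of [phi] is x -> x^(-q^3), a root fixed by that cube satisfies
   r^(q^3 + 1) = 1. *)
apply: (not_all_unit_circle _ _ _ _ K2 ab1 fr (m * 3)%N) => i.
have ris : r i \in s by rewrite mem_nth ?size_s.
have ri0 := s_neq0 _ ris.
have : phi (phi (phi (r i))) = r i.
  have [/eqP ri1|ri1] := boolP (r i ^+ q.+1 == 1).
    have /eqP pr : phi (r i) == r i by rewrite phi_fix // ri1 eqxx.
    by rewrite !pr.
  by apply: cyc; rewrite mem_filter ri1.
have -> : (2 ^ (m * 3) = q * q * q)%N by rewrite expnM -/q; lia.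
rewrite /phi !exprVn invrK => pr.
by rewrite exprS 2!exprM -[X in X * _]pr mulVf // !expf_neq0.
Qed.

(** * Roots on the unit circle when ab = 1 *)

(** The factor z^4 + b has at most one root, as fourth powers are injective. For m even, 2^m + 1 is
    2 modulo 3, so cubing is injective on the unit circle and z^3 + a has at most one root there. *)
Lemma unit_circle_niho_roots_degenerate (F : finFieldType) (m : nat) (a : F) :
  2%N \in [pchar F] -> a ^+ (2 ^ m).+1 = 1 ->
  let N := #|[set z : F | (z ^+ (2 ^ m).+1 == 1) &&
                          root (niho_poly a (a ^+ (2 ^ m))) z]| in
  (N <= 4)%N /\ (~~ odd m -> (N <= 2)%N).
Proof.
move=> F2 a1 /=; set A := [set z | _]; set b := a ^+ (2 ^ m) in A *.
have ab1 : a * b = 1 by rewrite -exprS.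
pose B := [set z : F | z ^+ 4 == b].
pose C := [set z : F | (z ^+ (2 ^ m).+1 == 1) && (z ^+ 3 == a)].
have AE : A \subset B :|: C.
  apply/fintype.subsetP => z; rewrite !inE => /andP[-> /rootP].
  rewrite horner_niho => fz; rewrite /= -subr_eq0 -[X in _ || X]subr_eq0.
  rewrite -mulf_eq0 !GRing.subr_pchar2 //; apply/eqP; rewrite -fz -ab1.
  by ring.
have B1 : (#|B| <= 1)%N.
  apply/card_le1_eqP => x y; rewrite !inE => /eqP <- /eqP /esym/eqP.
  rewrite -subr_eq0 GRing.subr_pchar2 // (_ : 4 = 2 ^ 2)%N // -exprDn_pchar2 //.
  by rewrite expf_eq0 /= -GRing.subr_pchar2 // subr_eq0 => /eqP.
have C3 : (#|C| <= 3)%N.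
  rewrite cardE -ltnS -(size_XnsubC a (ltn0Sn 2)).
  apply: max_poly_roots; rewrite ?enum_uniq ?monic_neq0 ?monicXnsubC //.
  apply/allP => z; rewrite mem_enum inE => /andP[_ /eqP z3].
  by rewrite /root !hornerE z3 subrr.
have ABC := leq_trans (subset_leq_card AE) (leq_card_setU B C).
split; first by rewrite (leq_trans ABC) // -[4%N]/(1 + 3)%N leq_add.
move=> m_even; rewrite (leq_trans ABC) // -[2%N]/(1 + 1)%N leq_add //.
have q3 : ((2 ^ m).+1 = 2 %[mod 3])%N.
  rewrite -[m]odd_double_half (negbTE m_even) -mul2n expnM -addn1.
  by rewrite -modnDml -modnXm exp1n.
apply/card_le1_eqP => x y; rewrite !inE.
move=> /andP[/eqP x1 /eqP x3] /andP[/eqP y1 /eqP y3].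
have y0 : y != 0.
  by apply/eqP => y0; move/eqP: y1; rewrite y0 expr0n eq_sym oner_eq0.
have t3 : (x / y) ^+ 3 = 1 by rewrite expr_div_n x3 -y3 divff ?expf_neq0.
have : (x / y) ^+ (2 ^ m).+1 = 1 by rewrite expr_div_n x1 y1 divr1.
rewrite -(expr_mod _ t3) q3 (expr_mod 2 t3) => t2.
by apply: (divIf y0); rewrite divff // -t3 exprS t2 mulr1.
Qed.

(** * Unit circle, subfield of order q and relative trace *)

Section NihoExponent.
Variables (F : finFieldType) (m : nat).
Hypotheses (F2 : 2%N \in [pchar F]) (m0 : (0 < m)%N).
Let q := (2 ^ m)%N.
Hypothesis cardF : #|F| = (q * q)%N.

Let circle := [set z : F | z ^+ q.+1 == 1].
(** The subfield of order q, written as the kernel of the relative trace. *)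
Let fixed := [set y : F | y + y ^+ q == 0].
(** The quotient of x by its conjugate: it maps the nonzero x onto the unit circle, and its fibers
    are the cosets of the unit group of the subfield. *)
Let slope (x : F) := x / x ^+ q.

Let q_gt0 : (0 < q)%N. Proof. by rewrite expn_gt0. Qed.

Lemma expf_qq (x : F) : x ^+ q ^+ q = x.
Proof. by rewrite -exprM -cardF expf_card. Qed.

Lemma fixedE y : (y \in fixed) = (y ^+ q == y).
Proof. by rewrite inE -GRing.subr_pchar2 // subr_eq0 eq_sym. Qed.

Lemma slope_circle x : x != 0 -> slope x \in circle.
Proof.
move=> x0; rewrite inE /slope exprS expr_div_n expf_qq.
have y0 : x ^+ q != 0 by rewrite expf_neq0.
by apply/eqP; field; rewrite x0 y0.
Qed.

(* In characteristic 2, [u] is the slope of its square root on the circle. *)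
Lemma card_slope_fiber u : u \in circle ->
  #|[set x | (x != 0) && (slope x == u)]| = #|fixed|.-1.
Proof.
rewrite inE => /eqP u1.
have fixed0 : 0 \in fixed by rewrite fixedE expr0n gtn_eqF.
rewrite (cardsD1 0 fixed) fixed0 /=.
(* Twice this exponent is q + 2, and u^(q + 1) = 1, so v^2 = u. *)
pose v := u ^+ (2 ^ m.-1).+1.
have v2 : v ^+ 2 = u.
  rewrite -exprM (_ : ((2 ^ m.-1).+1 * 2 = q.+1 + 1)%N) ?exprD ?u1 ?mul1r //.
  by rewrite /q -[in RHS](prednK m0) expnS; lia.
have v0 : v != 0.
  apply/eqP => v0; move/eqP: u1; rewrite -v2 v0 -exprM expr0n /=.
  by rewrite eq_sym oner_eq0.
have vq : v * v ^+ q = 1 by rewrite -exprS -exprM mulnC exprM u1 expr1n.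
rewrite -[RHS](card_imset _ (mulfI v0)); apply: eq_card => x; rewrite !inE.
apply/andP/imsetP.
  case=> x0 /eqP xu; exists (v^-1 * x); last by rewrite mulrA divff ?mul1r.
  rewrite in_setD1 mulf_neq0 ?invr_eq0 //= fixedE exprMn exprVn.
  have -> : (v ^+ q)^-1 = v.
    by rewrite -[RHS]mulr1 -(mulfV (expf_neq0 q v0)) mulrA vq mul1r.
  have xE : x = u * x ^+ q by rewrite -xu /slope divfK ?expf_neq0.
  by rewrite [in eqbRHS]xE -v2 expr2 !mulrA mulVf // mul1r.
case=> y; rewrite in_setD1 fixedE => /andP[y0 /eqP yq] ->.
rewrite mulf_neq0 // /slope exprMn yq; split=> //; apply/eqP.
have -> : v ^+ q = v^-1 by apply: (mulfI v0); rewrite vq divff.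
by rewrite -v2; field; rewrite v0 y0.
Qed.

Lemma card_slope_preim (D : {set F}) : D \subset circle ->
  #|[set x | (x != 0) && (slope x \in D)]| = (#|D| * #|fixed|.-1)%N.
Proof.
move=> Dc; rewrite -sum1_card (partition_big slope (mem D)) /=; last first.
  by move=> x; rewrite inE => /andP[].
rewrite -sum_nat_const; apply: eq_bigr => u uD.
rewrite sum1_card -(card_slope_fiber u) ?(fintype.subsetP Dc) //.
apply: eq_card => x; rewrite unfold_in !inE.
case: (slope x =P u) => [->|]; rewrite ?andbF //.
by rewrite uD !andbT.
Qed.

(** Root counting bounds [fixed] by q and [circle] by q + 1. Fibering the q^2 - 1 nonzero elements
    over [circle] forces equality. *)
Lemma card_fixed : #|fixed| = q.
Proof.
have q1 : (1 < q)%N by rewrite -[1%N](exp1n m) ltn_exp2r.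
have fixed_le : (#|fixed| <= q)%N.
  have szP : size ('X^q - 'X : {poly F}) = q.+1.
    by rewrite size_polyDl size_polyXn // size_polyN size_polyX.
  rewrite cardE -ltnS -szP; apply: max_poly_roots; rewrite ?enum_uniq //.
    by rewrite -size_poly_eq0 szP.
  apply/allP => y; rewrite mem_enum fixedE => /eqP yq.
  by rewrite /root !hornerE yq subrr.
have circle_le : (#|circle| <= q.+1)%N.
  rewrite cardE -ltnS -(size_XnsubC (1 : F) (ltn0Sn q)).
  apply: max_poly_roots; rewrite ?enum_uniq ?monic_neq0 ?monicXnsubC //.
  apply/allP => z; rewrite mem_enum inE => /eqP z1.
  by rewrite /root !hornerE z1 subrr.
have := card_slope_preim circle (subxx _).
have -> : #|[set x | (x != 0) && (slope x \in circle)]| = (q * q).-1.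
  rewrite -cardF -(cardsC1 (0 : F)); apply: eq_card => x; rewrite !inE.
  by have [//|/slope_circle] := eqVneq x 0; rewrite inE.
nia.
Qed.

(** Here d = 4q - 3. *)
Lemma niho_exponentE (d : nat) (x : F) : d = (4 * q.-1 + 1)%N -> x != 0 ->
  x ^+ d = (x ^+ q) ^+ 4 / x ^+ 3.
Proof.
move=> -> x0; apply: (mulIf (expf_neq0 3 x0)); rewrite divfK ?expf_neq0 //.
by rewrite -exprM -exprD; congr (_ ^+ _); move: q_gt0; clear; lia.
Qed.

(** For x nonzero and y = x^q, the relative trace times x^3 / y^4 is f(x / y). Its vanishing thus
    depends only on the slope, and each admissible slope has q - 1 preimages; the 1 counts x = 0. *)
Lemma card_trace_zero (d : nat) (a : F) : d = (4 * q.-1 + 1)%N ->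
  #|[set x : F | (x ^+ d + a * x) + (x ^+ d + a * x) ^+ q == 0]| =
  (1 + #|[set z : F | ((z ^+ q.+1 == 1) && root (niho_poly a (a ^+ q)) z)%R]|
       * q.-1)%N.
Proof.
move=> dE; set A := [set z | _ && _].
have A_circle : A \subset circle.
  by apply/fintype.subsetP => z; rewrite !inE => /andP[].
have := card_slope_preim A A_circle; rewrite card_fixed => <-.
have d0 : (0 < d)%N by rewrite dE addn1.
have c0 : 0 ^+ d + a * 0 = 0 by rewrite expr0n gtn_eqF // mulr0 addr0.
rewrite [LHS](cardsD1 0) inE c0 expr0n gtn_eqF // addr0 eqxx.
congr (_ + _)%N; apply: eq_card => x; rewrite !inE.
have [//|x0] := eqVneq x 0; have := slope_circle x x0; rewrite inE => -> /=.
rewrite niho_exponentE // exprDn_pchar2 // -/q expr_div_n [(a * x) ^+ q]exprMn.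
rewrite [x ^+ q ^+ 4 ^+ q]exprAC [x ^+ 3 ^+ q]exprAC.
rewrite expf_qq /root horner_niho /slope.
have y0 : x ^+ q != 0 by rewrite expf_neq0.
move: (x ^+ q) (a ^+ q) y0 => y b y0.
have -> : (x / y) ^+ 7 + a * (x / y) ^+ 4 + b * (x / y) ^+ 3 + 1 =
  x ^+ 3 / y ^+ 4 * (y ^+ 4 / x ^+ 3 + a * x + (x ^+ 4 / y ^+ 3 + b * y)).
  by field; rewrite x0 y0.
by rewrite mulf_eq0 mulf_eq0 invr_eq0 !expf_eq0 /= (negbTE x0) (negbTE y0).
Qed.
End NihoExponent.

(** * Absolute trace and additive character *)

Lemma trace_eltD (F : finFieldType) : {morph @trace_elt F : x y / x + y}.
Proof.
move=> x y; rewrite /trace_elt -big_split /=; apply: eq_bigr => i _.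
by rewrite exprDn_pchar // pnatX pnatE ?fcharP ?fchar_prime.
Qed.

Lemma trace_elt_exp_char (F : finFieldType) (x : F) k :
  trace_elt (x ^+ (fchar F ^ k)) = trace_elt x.
Proof.
elim: k => [|k IH]; first by rewrite expr1.
rewrite -IH expnSr exprM; set y := x ^+ _; rewrite -[RHS]trace_elt_frob.
rewrite /trace_elt -[RHS](pFrobenius_autE (fcharP F)) rmorph_sum /=.
by apply: eq_bigr => i _; rewrite pFrobenius_autE exprAC.
Qed.

(** The trace is a polynomial of degree below |F|, nonzero because its X coefficient is 1, so it
    cannot vanish on all of [F]. *)
Lemma trace_elt_neq0 (F : finFieldType) : exists x : F, trace_elt x != 0.
Proof.
have p1 := prime_gt1 (fchar_prime F).
pose P : {poly F} := \sum_(i < fdeg F) 'X^(fchar F ^ i).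
have PE x : P.[x] = trace_elt x.
  by rewrite /P horner_sum; apply: eq_bigr => i _; rewrite hornerXn.
have deg0 : (0 < fdeg F)%N.
  case: (fdeg F) (fdegE F) (finNzRing_gt1 F) => // ->; by rewrite ltnn.
have P0 : P != 0.
  apply/eqP => /(congr1 (fun p : {poly F} => p`_1)); rewrite coef0 coef_sum.
  rewrite (bigD1 (Ordinal deg0)) //= coefXn eqxx big1 ?addr0 => [/eqP|i i0].
    by rewrite oner_eq0.
  rewrite coefXn -(expn0 (fchar F)) eqn_exp2l // eq_sym.
  by move: i0; rewrite -val_eqE /= => /negbTE ->.
have szP : (size P <= #|F|)%N.
  rewrite fdegE; apply: (leq_trans (size_sum _ _ _)); apply/bigmax_leqP => i _.
  by rewrite size_polyXn ltn_exp2l.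
apply/existsP; apply: contraT; rewrite negb_exists => /forallP T0.
have rs : all (root P) (enum F).
  by apply/allP => x _; rewrite /root PE; have := T0 x; rewrite negbK.
by have := max_poly_roots P0 rs (enum_uniq F); rewrite -cardE ltnNge szP.
Qed.

Section Char2Psi.
Variables (R : realType) (F : finFieldType).
Hypothesis F2 : fchar F = 2%N.

Lemma pchar2 : 2%N \in [pchar F]. Proof. by rewrite -F2 fcharP. Qed.

Lemma psi_char2 (x : F) : psi R x = (-1) ^+ (trace_elt x != 0).
Proof.
have := ltn_ord (abs_trace x); have := abs_traceE x.
rewrite /psi; case: (abs_trace x) => t /= _ <-.
rewrite [in X in (t < X)%N]F2 F2 /=.
case: t => [|[|]] //= _.
  by rewrite eqxx mulr0 mul0r /cis cos0 sin0.
rewrite oner_eq0 /= mulr1 [2 * pi]mulrC mulfK ?pnatr_eq0 // /cis cospi sinpi.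
by apply/eqP; rewrite eq_complex /= oppr0 !eqxx.
Qed.

Lemma trace_elt_bool (x : F) : trace_elt x = (trace_elt x != 0)%:R.
Proof.
have /eqP := trace_elt_frob x; rewrite F2 -subr_eq0 expr2 -[X in _ - X]mulr1.
rewrite -mulrBr mulf_eq0 => /orP[/eqP ->|]; first by rewrite eqxx.
by rewrite subr_eq0 => /eqP ->; rewrite oner_eq0.
Qed.

Lemma psiD (x y : F) : psi R (x + y) = psi R x * psi R y.
Proof.
rewrite !psi_char2 trace_eltD -signr_addb; congr (_ ^+ _).
rewrite {1}(trace_elt_bool x) {1}(trace_elt_bool y).
case: (trace_elt x != 0); case: (trace_elt y != 0) => /=;
  by rewrite ?(addrr_pchar2 pchar2, addr0, add0r, eqxx, oner_eq0).
Qed.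

Lemma psi0 : psi R (0 : F) = 1.
Proof.
rewrite psi_char2 /trace_elt big1 ?eqxx // => i _.
by rewrite expr0n expn_eq0 F2.
Qed.

Lemma psi_frobenius (x : F) k : psi R (x ^+ (2 ^ k)) = psi R x.
Proof. by rewrite !psi_char2 -F2 trace_elt_exp_char. Qed.

Lemma sum_psi (c : F) : \sum_x psi R (x * c) = if c == 0 then #|F|%:R else 0.
Proof.
have [->|c0] := eqVneq c 0.
  by under eq_bigr do rewrite mulr0 psi0; rewrite sumr_const.
have [x0 tx0] := trace_elt_neq0 F.
have E : \sum_x psi R (x * c) = - \sum_x psi R (x * c).
  (* This translation multiplies every term by psi(x0) = -1. *)
  rewrite [LHS](reindex_inj (addrI (x0 / c))) /= -mulN1r mulr_sumr.
  apply: eq_bigr => x _; rewrite mulrDl psiD divfK //.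
  by rewrite psi_char2 tx0 expr1.
have : (\sum_x psi R (x * c)) *+ 2 == 0 by rewrite mulr2n {1}E addNr.
by rewrite mulrn_eq0 => /eqP.
Qed.

(** * The Weil sum in terms of the root count *)

Section Weil.
Variables (m d : nat) (a : F).
Let q := (2 ^ m)%N.
Hypotheses (m0 : (0 < m)%N) (cardF : #|F| = (q * q)%N).
Hypothesis dE : d = (4 * q.-1 + 1)%N.
Let relTr (x : F) := x + x ^+ q.

Lemma niho_exponent_fixed (y : F) : y ^+ q = y -> y ^+ d = y.
Proof.
move=> yq; have [->|y0] := eqVneq y 0.
  by rewrite expr0n dE addn1.
rewrite (niho_exponentE F m _ _ dE) // yq.
by apply: (mulIf (expf_neq0 3 y0)); rewrite divfK ?expf_neq0 // exprS.
Qed.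

(** The q-th power map preserves psi and turns v^q c into v c^q. *)
Lemma psi_relTr (v c : F) : psi R (relTr v * c) = psi R (v * relTr c).
Proof.
rewrite /relTr mulrDl mulrDr !psiD; congr (_ * _).
by rewrite -(psi_frobenius (_ * c) m) exprMn expf_qq.
Qed.

(** Substitute y x for x and use y^d = y; signs are immaterial in characteristic 2. *)
Lemma weil_sum_scale (y : F) : y != 0 -> y ^+ q = y ->
  \sum_x psi R (y * (x ^+ d + a * x)) = weil_sum R d a.
Proof.
move=> y0 yq; rewrite /weil_sum [RHS](reindex_inj (mulfI y0)) /=.
apply: eq_bigr => x _; rewrite [(y * x) ^+ d]exprMn (niho_exponent_fixed y) //.
rewrite GRing.subr_pchar2 ?pchar2 //.
by congr psi; ring.
Qed.

(* Sum [psi (relTr v * (x^d + a x))] over [v] and [x] in both orders. *)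
Lemma weil_sumE :
  weil_sum R d a = q%:R *
    (#|[set z : F | (z ^+ q.+1 == 1) && root (niho_poly a (a ^+ q)) z]|%:R - 1).
Proof.
set N := #|_|.
have F2' := pchar2.
have kerE : #|[set v | relTr v == 0]| = q.
  exact: (card_fixed F m F2' m0 cardF).
have relTr_fix v : relTr v ^+ q = relTr v.
  by rewrite /relTr exprDn_pchar2 // expf_qq // addrC.
have E : \sum_v \sum_x psi R (relTr v * (x ^+ d + a * x)) =
         \sum_x \sum_v psi R (v * relTr (x ^+ d + a * x)).
  rewrite exchange_big; apply: eq_bigr => x _; apply: eq_bigr => v _.
  exact: psi_relTr.
(* The q elements v of relative trace 0 contribute |F| each, all others one Weil sum each. *)
have lhs : \sum_v \sum_x psi R (relTr v * (x ^+ d + a * x)) =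
           (q * q)%:R *+ q + weil_sum R d a *+ (q * q - q).
  rewrite (bigID (fun v => relTr v == 0)) /=; congr (_ + _).
    rewrite -[X in _ = _ *+ X]kerE -sumr_const.
    apply: eq_big => v; rewrite ?inE // => /eqP ->.
    under eq_bigr do rewrite mul0r psi0.
    by rewrite sumr_const cardF.
  have kerC : #|~: [set v | relTr v == 0]| = (q * q - q)%N.
    by rewrite -cardF -(cardsC [set v | relTr v == 0]) kerE addKn.
  rewrite -[X in _ = _ *+ X]kerC -sumr_const.
  apply: eq_big => v; rewrite ?inE // => v0.
  exact: weil_sum_scale.
have rhs : \sum_x \sum_v psi R (v * relTr (x ^+ d + a * x)) =
           (q * q)%:R *+ (1 + N * q.-1).
  rewrite -(card_trace_zero F m F2' m0 cardF d a dE) -sumr_const.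
  rewrite [RHS]big_mkcond /=; apply: eq_bigr => x _.
  by rewrite inE sum_psi cardF.
have q1 : (1 < q)%N by rewrite -[1%N](exp1n m) ltn_exp2r.
have qE : q%:R = q.-1%:R + 1 :> R[i] by rewrite natr1 prednK // ltnW.
have p0 : q.-1%:R != 0 :> R[i] by rewrite pnatr_eq0 -lt0n -subn1 subn_gt0.
have q0 : q%:R != 0 :> R[i] by rewrite pnatr_eq0 -lt0n ltnW.
move: E; rewrite lhs rhs -[_ *+ q]mulr_natr -[_ *+ (_ - _)]mulr_natr.
rewrite -[_ *+ (_ + _)]mulr_natr natrB; last by rewrite leq_pmull // ltnW.
rewrite [(1 + _)%:R]natrD !natrM => E.
(* [E] reads q^3 + W (q^2 - q) = q^2 (1 + N (q - 1)), so the goal is multiplied by q (q - 1) and q^3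
   is added. With q = p + 1 the rest is a ring identity. *)
apply: (mulIf p0); apply: (mulIf q0); apply: (addrI (q%:R * q%:R * q%:R)).
move: E q0 p0; rewrite qE; move: (weil_sum _ _ _) (q.-1%:R) (N%:R) => W p n.
move=> E _ _.
transitivity ((p + 1) * (p + 1) * (p + 1) + W * ((p + 1) * (p + 1) - (p + 1))).
  by ring.
by rewrite E; ring.
Qed.
End Weil.
End Char2Psi.

(** * The sets of values *)

Lemma fchar_card4X (F : finFieldType) (m : nat) : (0 < m)%N ->
  #|F| = (4 ^ m)%N -> fchar F = 2%N.
Proof.
move=> m0 cardF.
have deg0 : (0 < fdeg F)%N.
  by case: (fdeg F) (fdegE F) (finNzRing_gt1 F) => // ->; rewrite ltnn.
have : (fchar F %| 2 ^ (2 * m))%N.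
  by rewrite expnM -cardF [X in (_ %| X)%N]fdegE dvdn_exp.
rewrite Euclid_dvdX ?fchar_prime // dvdn_prime2 ?fchar_prime //.
by case/andP=> /eqP.
Qed.

Lemma sqrt_card4X (R : realType) (F : finFieldType) (m : nat) :
  #|F| = (4 ^ m)%N -> sqrt_card R F = (2 ^ m)%:R.
Proof.
move=> cardF; rewrite /sqrt_card cardF -[4%N]/(2 ^ 2)%N -expnM mulnC expnM.
by rewrite natrX sqrtr_sqr ger0_norm.
Qed.

Local Open Scope classical_set_scope.

Theorem theorem1p3 (R : realType) (m : nat) (F : finFieldType) (d : nat)
    (hm : (0 < m)%N) (hF : #|F| = (4 ^ m)%N)
    (hd : d%:R = 4 * (sqrt_card R F - 1) + 1 :> R) :
  [/\ (~~ odd m -> weil_values R F d `<=` [set -1; 0; 1; 2; 4]),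
      (odd m -> (1 < m)%N -> weil_values R F d `<=` [set -1; 0; 1; 2; 3; 4]) &
      (#|F| = 4%N -> degenerate F d /\ weil_values R F d = [set 0; 2])].
Proof.
have p2 := fchar_card4X F m hm hF; have F2 := pchar2 F p2.
have sqrtF := sqrt_card4X R F m hF.
have cardF : #|F| = (2 ^ m * 2 ^ m)%N by rewrite hF -expnMn.
have dE : d = (4 * (2 ^ m).-1 + 1)%N.
  have qE : (2 ^ m)%:R = (2 ^ m).-1%:R + 1 :> R.
    by rewrite natr1 prednK ?expn_gt0.
  by apply/eqP; rewrite -(eqr_nat R) hd sqrtF natrD natrM qE addrK.
have q0 : (2 ^ m)%:R != 0 :> R[i] by rewrite pnatr_eq0 expn_eq0.
(* The normalised value is N - 1; the alternatives are ab different from 1 and ab = 1, and N = 4 can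
   occur only in the second. *)
have valuesE w : weil_values R F d w ->
    exists2 N : nat, w = N%:R - 1 &
      (N \in [:: 0; 1; 2; 3; 5]%N) \/ (N <= 4)%N /\ (~~ odd m -> (N <= 2)%N).
  case=> a _ ->; rewrite sqrtF rmorph_nat (weil_sumE R F p2 m d a hm cardF dE).
  rewrite [_ * (_ - 1)]mulrC mulfK //; eexists; first by [].
  have [a1|a1] := eqVneq (a ^+ (2 ^ m).+1) 1.
    by right; apply: unit_circle_niho_roots_degenerate.
  by left; apply: unit_circle_niho_roots.
have natrS1 n : n.+1%:R - 1 = n%:R :> R[i] by rewrite -natr1 addrK.
split.
- move=> m_even w /valuesE[N ->] [|[_ /(_ m_even)]].
    rewrite !inE => /or4P[||| /orP[]] /eqP ->.
    + by rewrite sub0r; do 4!left.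
    + by rewrite subrr; do 3!left; right.
    + by rewrite natrS1; do 2!left; right.
    + by rewrite natrS1; left; right.
    + by rewrite natrS1; right.
  case: N => [|[|[|]]] // _.
  + by rewrite sub0r; do 4!left.
  + by rewrite subrr; do 3!left; right.
  + by rewrite natrS1; do 2!left; right.
- move=> _ _ w /valuesE[N ->] N_le.
  have {N_le} : (N <= 5)%N.
    case: N_le => [|[N4 _]]; last exact: leqW.
    by rewrite !inE => /or4P[||| /orP[]] /eqP ->.
  case: N => [|[|[|[|[|[|]]]]]] // _.
  + by rewrite sub0r; do 5!left.
  + by rewrite subrr; do 4!left; right.
  + by rewrite natrS1; do 3!left; right.
  + by rewrite natrS1; do 2!left; right.
  + by rewrite natrS1; left; right.
  + by rewrite natrS1; right.
move=> F4.
have m1 : m = 1%N.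
  by apply/eqP; rewrite -(eqn_exp2l m 1 (isT : 1 < 4)%N) -hF F4.
move: sqrtF dE; rewrite m1 expn1 => sqrtF dE.
have d5 : d = 5%N by rewrite dE.
(* 5 is 2 modulo 3. *)
split; first by exists 1%N; rewrite p2 F4 d5.
(* On the field of order 4, x^5 = x^2 and psi(x^2) = psi(x), so the sum is that of the linear
   character x -> psi(x (1 + a)). *)
have weilE (a : F) : weil_sum R d a = if 1 + a == 0 then 4 else 0.
  transitivity (\sum_x psi R (x * (1 + a))); last first.
    by rewrite (sum_psi R F p2) F4.
  apply: eq_bigr => x _.
  rewrite GRing.subr_pchar2 // mulrDr mulr1 !(psiD _ _ p2) [a * x]mulrC.
  congr (_ * _); rewrite -(psi_frobenius R F p2 x 1); congr psi.
  by rewrite d5 exprSr -F4 expf_card.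
have add2 (x : F) : x + x = 0 by exact: addrr_pchar2.
have sqrtE : real_complex R (sqrt_card R F) = 2 by rewrite sqrtF rmorph_nat.
have two0 : 2 != 0 :> R[i] by rewrite pnatr_eq0.
apply/seteqP; split=> [w [a _ ->]|w].
  rewrite sqrtE weilE; case: ifP => _; [right|left]; last by rewrite mul0r.
  by apply: (mulIf two0); rewrite divfK // -natrM.
case=> ->; rewrite /weil_values /= sqrtE; last first.
  exists 1; first exact: unitr1.
  rewrite weilE add2 eqxx.
  by apply: (mulIf two0); rewrite divfK // -natrM.
(* The value 2 came from a = 1; the value 0 needs a unit other than 1. *)
have [a _] : exists2 a : F, a \in F & a \notin [:: 0; 1].
  apply/fintype.subsetPn/negP => /subset_leq_card; rewrite F4.
  by move/leq_trans => /(_ _ (card_size _)).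
rewrite !inE negb_or => /andP[a0 a1]; exists a; first by rewrite unitfE.
by rewrite weilE -GRing.subr_pchar2 // subr_eq0 eq_sym (negbTE a1) mul0r.
Qed.
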